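(* Let $R$ be an associative ring with identity. The following assertions are equivalent: (1) Any flat left $R$-module is f-projective. (2) Any flat left $R$-module is Mittag-Leffler. (3) $\mathfrak{F}^{-1}(M)=\underline{\mathfrak{Pr}}^{-1}(M)$ for any finitely generated left $R$-module $M$. (4) The class of all modules $N$ such that $N\in\mathfrak{F}^{-1}(M)$ for every finitely generated module $M$ is precisely the class of f-projective modules.
   Context: Modules are unital left $R$-modules. A module $M$ is f-projective if for every finitely generated submodule $C$ of $M$ the inclusion map $C\to M$ factors through a finitely generated free module. A module $M$ is Mittag-Leffler (in the sense used here) if for every finitely generated submodule $C$ of $M$ the inclusion map $C\to M$ factors through a finitely presented module. A flat precover of a module $N$ is a morphism $g:F\to N$ with $F$ flat such that $\mathrm{Hom}(F',F)\to\mathrm{Hom}(F',N)$ is surjective for every flat module $F'$. The flat-precover completing domain $\mathfrak{F}^{-1}(M)$ is the class of all modules $N$ such that for every morphism $f:M\to N$ and every flat precover $g:F\to N$ there is a morphism $h:M\to F$ with $gh=f$. The subprojectivity domain $\underline{\mathfrak{Pr}}^{-1}(M)$ is the class of all modules $N$ such that for every epimorphism $g:B\to N$ and every morphism $f:M\to N$ there is a morphism $h:M\to B$ with $gh=f$. *)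

(* Defs.v *)
From HB Require Import structures.
From mathcomp Require Import all_boot all_algebra.
From mathcomp Require Import generic_quotient ring_quotient.
From mathcomp Require Import boolp.
From mathcomp Require Import freeg.

Set Implicit Arguments.
Unset Strict Implicit.
Unset Printing Implicit Defensive.

Import GRing.Theory.
Local Open Scope ring_scope.
Local Open Scope quotient_scope.

(* Left R-modules are the objects of lmodType R.  Right R-modules are the      *)
(* objects of lmodType R^c, with a.r rendered as (r : R^c) *: a.  Rings are    *)
(* pzRingType, so the zero ring is not excluded.                               *)

(* The subgroup of the free abelian group on A * M by which one divides to     *)
(* obtain the tensor product of the right module A and the left module M.      *)
Inductive tensor_rel (R : pzRingType) (A : lmodType R^c) (M : lmodType R) :
    {freeg (A * M)%type} -> Prop :=
  | TensorRel0 : tensor_rel 0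
  | TensorRelB u v : tensor_rel u -> tensor_rel v -> tensor_rel (u - v)
  | TensorRelDl a b x :
      tensor_rel (<< (a + b, x) >> - << (a, x) >> - << (b, x) >>)
  | TensorRelDr a x y :
      tensor_rel (<< (a, x + y) >> - << (a, x) >> - << (a, y) >>)
  | TensorRelZ a (r : R) x :
      tensor_rel (<< ((r : R^c) *: a, x) >> - << (a, r *: x) >>).

Definition tensor_relb (R : pzRingType) (A : lmodType R^c) (M : lmodType R) :
    {pred {freeg (A * M)%type}} := fun u => `[< tensor_rel u >].

Lemma tensor_rel_zmod_closed (R : pzRingType) (A : lmodType R^c)
  (M : lmodType R) : zmod_closed (@tensor_relb R A M).
Proof.
split=> [|u v /asboolP uR /asboolP vR]; apply/asboolP.
  exact: TensorRel0.
exact: TensorRelB.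
Qed.

HB.instance Definition _ (R : pzRingType) (A : lmodType R^c) (M : lmodType R) :=
  GRing.isZmodClosed.Build {freeg (A * M)%type} (@tensor_relb R A M)
    (@tensor_rel_zmod_closed R A M).

Definition tensor (R : pzRingType) (A : lmodType R^c) (M : lmodType R) :
  zmodType := Quotient.quot (@tensor_relb R A M).

Definition to_tensor (R : pzRingType) (A : lmodType R^c) (M : lmodType R)
  (u : {freeg (A * M)%type}) : tensor A M :=
  \pi_(Quotient.quot (@tensor_relb R A M)) u.

Definition tens (R : pzRingType) (A : lmodType R^c) (M : lmodType R)
  (a : A) (x : M) : tensor A M := to_tensor << (a, x) >>.

Definition fgmap_tensor (R : pzRingType) (A B : lmodType R^c) (M : lmodType R)
  (f : A -> B) (u : {freeg (A * M)%type}) : {freeg (B * M)%type} :=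
  fglift (fun ax => << (f ax.1, ax.2) >>) u.

(* The map f (x) id_M.  It is computed on a representative;                    *)
(* tensor_map_to_tensor shows that the choice does not matter.                 *)
Definition tensor_map (R : pzRingType) (A B : lmodType R^c) (M : lmodType R)
  (f : {linear A -> B}) (t : tensor A M) : tensor B M :=
  to_tensor (fgmap_tensor f (repr t)).

Lemma to_tensor_eq (R : pzRingType) (A : lmodType R^c) (M : lmodType R)
  (u v : {freeg (A * M)%type}) :
  to_tensor u = to_tensor v <-> tensor_rel (u - v).
Proof.
rewrite /to_tensor; split=> [/eqP|/asboolP H].
  by rewrite -Quotient.idealrBE => /asboolP.
by apply/eqP; rewrite -Quotient.idealrBE.
Qed.

Lemma to_tensorB (R : pzRingType) (A : lmodType R^c) (M : lmodType R) :
  {morph @to_tensor R A M : u v / u - v}.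
Proof. by move=> u v; rewrite /to_tensor !piE. Qed.

Lemma fgmap_tensorB (R : pzRingType) (A B : lmodType R^c) (M : lmodType R)
  (f : A -> B) : {morph @fgmap_tensor R A B M f : u v / u - v}.
Proof. exact: lift_is_additive. Qed.

Lemma fgmap_tensorU (R : pzRingType) (A B : lmodType R^c) (M : lmodType R)
  (f : A -> B) (a : A) (x : M) :
  fgmap_tensor f << (a, x) >> = << (f a, x) >>.
Proof. by rewrite /fgmap_tensor liftU scale1r. Qed.

Lemma tensor_map_to_tensor (R : pzRingType) (A B : lmodType R^c)
  (M : lmodType R) (f : {linear A -> B}) (u : {freeg (A * M)%type}) :
  tensor_map f (to_tensor u) = to_tensor (fgmap_tensor f u).
Proof.
rewrite /tensor_map; apply/to_tensor_eq; rewrite -fgmap_tensorB.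
have: tensor_rel (repr (to_tensor u) - u).
  by apply/to_tensor_eq; rewrite /to_tensor reprK.
elim=> [|v w _ vR _ wR|a b x|a x y|a r x].
- by rewrite -[0](subrr 0) fgmap_tensorB subrr; apply: TensorRel0.
- by rewrite fgmap_tensorB; apply: TensorRelB.
- by rewrite !fgmap_tensorB !fgmap_tensorU linearD; apply: TensorRelDl.
- by rewrite !fgmap_tensorB !fgmap_tensorU; apply: TensorRelDr.
- by rewrite !fgmap_tensorB !fgmap_tensorU linearZ; apply: TensorRelZ.
Qed.

Lemma tensor_map_tens (R : pzRingType) (A B : lmodType R^c) (M : lmodType R)
  (f : {linear A -> B}) (a : A) (x : M) :
  tensor_map f (tens a x) = tens (f a) x.
Proof. by rewrite tensor_map_to_tensor fgmap_tensorU. Qed.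

Lemma tensor_mapB (R : pzRingType) (A B : lmodType R^c) (M : lmodType R)
  (f : {linear A -> B}) : {morph @tensor_map R A B M f : s t / s - t}.
Proof.
move=> s t.
have E w : w = @to_tensor R A M (repr w) by rewrite /to_tensor reprK.
rewrite (E s) (E t).
by rewrite -to_tensorB !tensor_map_to_tensor fgmap_tensorB to_tensorB.
Qed.

Definition flat (R : pzRingType) (M : lmodType R) : Prop :=
  forall (A B : lmodType R^c) (f : {linear A -> B}),
    injective f -> injective (@tensor_map R A B M f).

Definition epi (R : pzRingType) (B N : lmodType R) (g : {linear B -> N}) : Prop :=
  forall y, exists x, g x = y.

Definition finitely_generated (R : pzRingType) (M : lmodType R) : Prop :=
  exists (n : nat) (e : 'I_n -> M),
    forall x, exists c : 'I_n -> R, x = \sum_(i < n) c i *: e i.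

Definition fg_free (R : pzRingType) (M : lmodType R) : Prop :=
  exists (n : nat) (f : {linear 'rV[R]_n -> M}), bijective f.

(* There is an exact sequence R^m -> R^n -> M -> 0.                            *)
Definition finitely_presented (R : pzRingType) (M : lmodType R) : Prop :=
  exists (m n : nat) (q : {linear 'rV[R]_m -> 'rV[R]_n})
         (p : {linear 'rV[R]_n -> M}),
    epi p /\ forall v, p v = 0 <-> exists w, q w = v.

Definition factors_through (R : pzRingType) (C M P : lmodType R)
  (f : {linear C -> M}) : Prop :=
  exists (u : {linear C -> P}) (v : {linear P -> M}), forall x, v (u x) = f x.

(* A submodule of M is a boolean predicate S on M together with a              *)
(* subLmodType structure C on it; the inclusion map is \val : C -> M.          *)
Definition f_projective (R : pzRingType) (M : lmodType R) : Prop :=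
  forall (S : pred M) (C : subLmodType S), finitely_generated C ->
    exists P : lmodType R, fg_free P /\ factors_through P (\val : {linear C -> M}).

Definition mittag_leffler (R : pzRingType) (M : lmodType R) : Prop :=
  forall (S : pred M) (C : subLmodType S), finitely_generated C ->
    exists P : lmodType R,
      finitely_presented P /\ factors_through P (\val : {linear C -> M}).

Definition flat_precover (R : pzRingType) (F N : lmodType R)
  (g : {linear F -> N}) : Prop :=
  flat F /\
  forall F' : lmodType R, flat F' -> forall f : {linear F' -> N},
    exists h : {linear F' -> F}, forall x, g (h x) = f x.

(* N belongs to the flat-precover completing domain of M.                      *)
Definition flat_precover_completing_domain (R : pzRingType)
  (M N : lmodType R) : Prop :=
  forall (f : {linear M -> N}) (F : lmodType R) (g : {linear F -> N}),
    flat_precover g -> exists h : {linear M -> F}, forall x, g (h x) = f x.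

(* N belongs to the subprojectivity domain of M.                               *)
Definition subprojectivity_domain (R : pzRingType) (M N : lmodType R) : Prop :=
  forall (B : lmodType R) (g : {linear B -> N}) (f : {linear M -> N}),
    epi g -> exists h : {linear M -> B}, forall x, g (h x) = f x.

(* Main.v *)
From HB Require Import structures.
From mathcomp Require Import all_boot all_algebra.
From mathcomp Require Import generic_quotient ring_quotient.
From mathcomp Require Import boolp classical_sets functions freeg.
Require Import Defs.

(* Flatness of M is the equational criterion: every solution x of A x = 0 in   *)
(* M^n lies in the image of ker A (x) M.  It makes every map from a finitely   *)
(* presented module to a flat module factor through some R^k, hence (2)        *)
(* implies (1).  A module N is f-projective if and only if it lies in the      *)
(* subprojectivity domain of every finitely generated module, so (3) implies   *)
(* (4); and a flat precover of a flat module splits, so (4) implies (1).       *)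
(*                                                                             *)
(* That (2) implies (3) rests on the existence of flat precovers.  Given       *)
(* f : F -> N with F flat, let K be maximal among the pure submodules of F     *)
(* contained in ker f, so that F / K is flat.  Form terms by closing one       *)
(* variable under linear combinations and chosen solutions of linear systems,  *)
(* each term t being evaluated as a map F -> F.  If f (t x) = f (t y) for all  *)
(* t, then the differences t x - t y generate, modulo K, a pure submodule      *)
(* inside ker f, and so x - y lies in K by maximality.  Thus F / K embeds into *)
(* the set of functions from terms to N, which does not depend on F, and the   *)
(* direct sum of all flat quotients of the free module on that set, with all   *)
(* their maps to N, is a flat precover.                                        *)

Set Implicit Arguments.
Unset Strict Implicit.
Unset Printing Implicit Defensive.

Import GRing.Theory.
Local Open Scope ring_scope.
Local Open Scope quotient_scope.
Local Open Scope classical_set_scope.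

(** * Submodules and quotients *)

(** Flatness is handled throughout as [eq_flat], by [eq_flat_flat] and [flat_eq_flat]. The
    subprojectivity domain always lies inside the completing domain, since flat precovers are onto
    ([flat_precover_epi]). For the converse under (2), a map from a finitely generated [M] to [N]
    lifts to a flat precover, given by [exists_flat_precover]. By [factors_through_image] the lift
    passes through a finitely presented module, and by [flat_fp_factor] through some [R^k], from
    which maps lift along any epimorphism. The precover exists because [small_flat_factor] bounds
    the size of the flat modules needed. Finally, [subprojectivity_f_projective] turns (3) into
    (4). *)

Record submodule (R : pzRingType) (V : lmodType R) := Submodule {
  in_submod :> V -> Prop;
  submod0 : in_submod 0;
  submodZD : forall a x y, in_submod x -> in_submod y -> in_submod (a *: x + y)
}.

Section SubmoduleTheory.
Variables (R : pzRingType) (V : lmodType R) (K : submodule V).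
Implicit Types x y : V.

Lemma submodD x y : K x -> K y -> K (x + y).
Proof. by move=> Kx Ky; rewrite -[x]scale1r; apply: submodZD. Qed.

Lemma submodZ a x : K x -> K (a *: x).
Proof. by move=> Kx; rewrite -[_ *: _]addr0; apply: submodZD (submod0 K). Qed.

Lemma submodN x : K x -> K (- x).
Proof. by rewrite -scaleN1r; apply: submodZ. Qed.

Lemma submodB x y : K x -> K y -> K (x - y).
Proof. by move=> Kx /submodN; apply: submodD. Qed.

Lemma submod_sum (I : Type) (r : seq I) (P : pred I) (F : I -> V) :
  (forall i, P i -> K (F i)) -> K (\sum_(i <- r | P i) F i).
Proof. by move=> KF; elim/big_ind: _ => //; [exact: submod0|exact: submodD]. Qed.

Definition submodb : {pred V} := fun x => `[< K x >].

Lemma submodb_closed : submod_closed submodb.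
Proof.
split=> [|a x y /asboolP Kx /asboolP Ky]; apply/asboolP; first exact: submod0.
exact: submodZD.
Qed.

HB.instance Definition _ :=
  GRing.isSubmodClosed.Build R V submodb submodb_closed.

Inductive submod_type := SubmodType x of submodb x.
Definition submod_val (u : submod_type) := let: SubmodType x _ := u in x.
HB.instance Definition _ := [isSub for submod_val].
HB.instance Definition _ := [Choice of submod_type by <:].
HB.instance Definition _ := [SubChoice_isSubLmodule of submod_type by <:].

Definition quotmod := Quotient.quot submodb.
HB.instance Definition _ := GRing.Zmodule.on quotmod.

Definition to_quot (x : V) : quotmod := \pi_quotmod x.

Lemma to_quotB : {morph to_quot : x y / x - y}.
Proof. by move=> x y; rewrite /to_quot !piE. Qed.

Lemma to_quot_eq x y : to_quot x = to_quot y <-> K (x - y).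
Proof.
rewrite /to_quot; split=> [/eqP|/asboolP H].
  by rewrite -Quotient.idealrBE => /asboolP.
by apply/eqP; rewrite -Quotient.idealrBE.
Qed.

Lemma to_quotK u : to_quot (repr u) = u. Proof. exact: reprK. Qed.

Lemma to_quotD : {morph to_quot : x y / x + y}.
Proof. by move=> x y; rewrite /to_quot !piE. Qed.

Definition quot_scale (a : R) (u : quotmod) : quotmod := to_quot (a *: repr u).

Lemma quot_scaleE a x : quot_scale a (to_quot x) = to_quot (a *: x).
Proof.
apply/to_quot_eq; rewrite -scalerBr; apply: submodZ.
by apply/to_quot_eq; rewrite to_quotK.
Qed.

Lemma quot_scaleA a b u : quot_scale a (quot_scale b u) = quot_scale (a * b) u.
Proof. by rewrite -[u]to_quotK !quot_scaleE scalerA. Qed.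

Lemma quot_scale1 : left_id 1 quot_scale.
Proof. by move=> u; rewrite -[u]to_quotK !quot_scaleE scale1r. Qed.

Lemma quot_scaleDr : right_distributive quot_scale +%R.
Proof.
by move=> a u v; rewrite -[u]to_quotK -[v]to_quotK -to_quotD !quot_scaleE
  scalerDr to_quotD.
Qed.

Lemma quot_scaleDl u : {morph quot_scale^~ u : a b / a + b}.
Proof. by move=> a b; rewrite -[u]to_quotK !quot_scaleE scalerDl to_quotD. Qed.

HB.instance Definition _ := GRing.Zmodule_isLmodule.Build R quotmod
  quot_scaleA quot_scale1 quot_scaleDr quot_scaleDl.

Lemma to_quot_linear : linear to_quot.
Proof. by move=> a x y; rewrite to_quotD -quot_scaleE. Qed.

HB.instance Definition _ := GRing.isLinear.Build R V quotmod _ to_quot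
  to_quot_linear.

End SubmoduleTheory.

(** * Free modules *)

Section FreeModule.
Variables (R : pzRingType) (X : choiceType).

Definition finite_support (w : X -> R^o) : Prop :=
  exists s : seq X, forall x, x \notin s -> w x = 0.

Lemma finite_support0 : finite_support 0.
Proof. by exists [::]. Qed.

Lemma finite_supportZD a v w :
  finite_support v -> finite_support w -> finite_support (a *: v + w).
Proof.
move=> [s vs] [t wt]; exists (s ++ t) => x; rewrite mem_cat => /norP[xs xt].
have -> : (a *: v + w) x = a * v x + w x by [].
by rewrite vs ?wt // mulr0 addr0.
Qed.

Definition free_submod := Submodule finite_support0 finite_supportZD.

Definition free : lmodType R := submod_type free_submod.

Definition coef (w : free) : X -> R := val w.

Lemma coefD v w x : coef (v + w) x = coef v x + coef w x.
Proof. by rewrite /coef linearD. Qed.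

Lemma coefZ a v x : coef (a *: v) x = a * coef v x.
Proof. by rewrite /coef linearZ. Qed.

Lemma coef0 x : coef 0 x = 0.
Proof. by rewrite /coef linear0. Qed.

Lemma coef_sum (I : Type) (r : seq I) (F : I -> free) x :
  coef (\sum_(i <- r) F i) x = \sum_(i <- r) coef (F i) x.
Proof.
elim: r => [|i r IH]; first by rewrite !big_nil coef0.
by rewrite !big_cons coefD IH.
Qed.

Lemma coef_inj v w : (forall x, coef v x = coef w x) -> v = w.
Proof. by move=> vw; apply: val_inj; apply: funext. Qed.

Lemma supp_subproof (w : free) :
  exists s : seq X, uniq s /\ forall x, x \notin s -> coef w x = 0.
Proof.
have /asboolP[s ws] := valP w.
by exists (undup s); rewrite undup_uniq; split=> // x; rewrite mem_undup => /ws.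
Qed.

Definition supp (w : free) := proj1_sig (cid (supp_subproof w)).

Lemma supp_uniq w : uniq (supp w).
Proof. by rewrite /supp; case: cid => s []. Qed.

Lemma coef_supp w x : x \notin supp w -> coef w x = 0.
Proof. by rewrite /supp; case: cid => s [] _ /[apply]. Qed.

Lemma dirac_subproof (x : X) :
  submodb free_submod (fun y => (y == x)%:R).
Proof. by apply/asboolP; exists [:: x] => y; rewrite inE => /negbTE ->. Qed.

Definition dirac (x : X) : free := SubmodType (dirac_subproof x).

Lemma coef_dirac x y : coef (dirac x) y = (y == x)%:R.
Proof. by []. Qed.

Section Extension.
Variables (M : lmodType R) (g : X -> M).

Definition free_ext (w : free) : M := \sum_(x <- supp w) coef w x *: g x.

(** [supp w] is an arbitrarily chosen list that may contain zeros of [w]; this gives independence of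
    that choice. *)
Lemma free_extE (w : free) (s : seq X) :
  uniq s -> (forall x, x \notin s -> coef w x = 0) ->
  free_ext w = \sum_(x <- s) coef w x *: g x.
Proof.
move=> s_uniq ws; rewrite /free_ext.
rewrite (bigID (fun x => coef w x == 0)) /= big1 ?add0r; last first.
  by move=> x /eqP ->; rewrite scale0r.
rewrite [RHS](bigID (fun x => coef w x == 0)) /= [X in _ = X + _]big1 ?add0r;
  last by move=> x /eqP ->; rewrite scale0r.
rewrite -big_filter -[RHS]big_filter; apply: perm_big; apply: uniq_perm.
- exact/filter_uniq/supp_uniq.
- exact/filter_uniq.
move=> x; rewrite !mem_filter; case: eqP => //= nz.
by apply/idP/idP => _; apply: contra_notT nz; [exact: ws|exact: coef_supp].
Qed.

Lemma free_ext_linear : linear free_ext.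
Proof.
move=> a v w; set s := undup (supp v ++ supp w).
have su : uniq s by exact: undup_uniq.
have vs x : x \notin s -> coef v x = 0.
  by rewrite mem_undup mem_cat => /norP[xv _]; apply: coef_supp.
have ws x : x \notin s -> coef w x = 0.
  by rewrite mem_undup mem_cat => /norP[_ xw]; apply: coef_supp.
rewrite (free_extE su vs) (free_extE su ws) (@free_extE _ s) //; last first.
  by move=> x xs; rewrite coefD coefZ vs ?ws // mulr0 addr0.
rewrite scaler_sumr -big_split; apply: eq_bigr => x _ /=.
by rewrite coefD coefZ scalerDl scalerA.
Qed.

HB.instance Definition _ :=
  GRing.isLinear.Build R free M _ free_ext free_ext_linear.

Lemma free_ext_dirac x : free_ext (dirac x) = g x.
Proof.
rewrite (@free_extE _ [:: x]) // ?big_seq1 ?coef_dirac ?eqxx ?scale1r //.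
by move=> y; rewrite inE coef_dirac => /negbTE ->.
Qed.

End Extension.

Lemma free_decomp (w : free) : w = \sum_(x <- supp w) coef w x *: dirac x.
Proof.
apply: coef_inj => y; rewrite coef_sum.
under eq_bigr => x _ do rewrite coefZ coef_dirac.
case: (boolP (y \in supp w)) => ys; last first.
  rewrite coef_supp // big1_seq // => x /andP[_ xs].
  by case: eqP ys xs => [->/negbTE ->//|]; rewrite mulr0.
rewrite (bigD1_seq y) ?supp_uniq //= eqxx mulr1 big1 ?addr0 // => x.
by rewrite eq_sym => /negbTE ->; rewrite mulr0.
Qed.

Lemma free_linear_eq (M : lmodType R) (f g : {linear free -> M}) :
  (forall x, f (dirac x) = g (dirac x)) -> f =1 g.
Proof.
move=> fg w; rewrite [w]free_decomp !linear_sum.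
by apply: eq_bigr => x _; rewrite !linearZ fg.
Qed.

End FreeModule.

(** * Tensor products *)

Section TensorElements.
Variables (R : pzRingType) (A : lmodType R^c) (M : lmodType R).

Lemma to_tensor0 : to_tensor 0 = 0 :> tensor A M.
Proof. by rewrite -[0](subrr 0) to_tensorB subrr. Qed.

HB.instance Definition _ := GRing.isZmodMorphism.Build _ _ (@to_tensor R A M)
  (@to_tensorB R A M).

Lemma to_tensor_eq0 u : to_tensor u = 0 :> tensor A M <-> tensor_rel u.
Proof. by rewrite -to_tensor0 to_tensor_eq subr0. Qed.

Lemma tensDl (a b : A) (x : M) : tens (a + b) x = tens a x + tens b x.
Proof.
apply/eqP; rewrite -subr_eq0 opprD addrA /tens -!raddfB; apply/eqP.
by apply/to_tensor_eq0/TensorRelDl.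
Qed.

Lemma tensDr (a : A) (x y : M) : tens a (x + y) = tens a x + tens a y.
Proof.
apply/eqP; rewrite -subr_eq0 opprD addrA /tens -!raddfB; apply/eqP.
by apply/to_tensor_eq0/TensorRelDr.
Qed.

Lemma tensZ (a : A) (r : R) (x : M) : tens ((r : R^c) *: a) x = tens a (r *: x).
Proof. by apply/to_tensor_eq/TensorRelZ. Qed.

Lemma tens0l (x : M) : tens (0 : A) x = 0.
Proof. by apply: (@addrI _ (tens 0 x)); rewrite -tensDl !addr0. Qed.

Lemma tens0r (a : A) : tens a (0 : M) = 0.
Proof. by apply: (@addrI _ (tens a 0)); rewrite -tensDr !addr0. Qed.

Lemma tensNl (a : A) (x : M) : tens (- a) x = - tens a x.
Proof. by apply/eqP; rewrite -addr_eq0 -tensDl addNr tens0l. Qed.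

Lemma tens_suml (I : Type) (r : seq I) (F : I -> A) (x : M) :
  tens (\sum_(i <- r) F i) x = \sum_(i <- r) tens (F i) x.
Proof.
elim: r => [|i r IH]; first by rewrite !big_nil tens0l.
by rewrite !big_cons tensDl IH.
Qed.

Lemma tens_sumr (I : Type) (r : seq I) (a : A) (F : I -> M) :
  tens a (\sum_(i <- r) F i) = \sum_(i <- r) tens a (F i).
Proof.
elim: r => [|i r IH]; first by rewrite !big_nil tens0r.
by rewrite !big_cons tensDr IH.
Qed.

Definition tens_sum (l : seq (A * M)) : tensor A M :=
  \sum_(z <- l) tens z.1 z.2.

Lemma tensor_tens_sum (t : tensor A M) : exists l, t = tens_sum l.
Proof.
have -> : t = to_tensor (repr t) by rewrite /to_tensor reprK.
have tens_sum_cat l1 l2 : tens_sum (l1 ++ l2) = tens_sum l1 + tens_sum l2.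
  by rewrite /tens_sum big_cat.
have mul (l : seq (A * M)) n : exists l', tens_sum l *+ n = tens_sum l'.
  elim: n => [|n [l' IH]]; first by exists [::]; rewrite mulr0n /tens_sum big_nil.
  by exists (l ++ l'); rewrite mulrS IH tens_sum_cat.
elim/freeg_ind_dom0: (repr t) => [|k [a x] D _ _ [l IH]].
  by exists [::]; rewrite raddf0 /tens_sum big_nil.
have -> : << k *g (a, x) >> = << (a, x) >> *~ k :> {freeg (A * M)%type}.
  by rewrite freegU_mulz intz.
(* Integer coefficients are absorbed by repetition, and a negative sign by negating the left
   factor. *)
have [l' Hl'] : exists l', tens a x *~ k = tens_sum l'.
  case: k => n; first by rewrite -pmulrn; have := mul [:: (a, x)] n; rewrite /tens_sum big_seq1.
  have := mul [:: (- a, x)] n.+1; rewrite /tens_sum big_seq1 /= tensNl => -[l' E].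
  by exists l'; rewrite -E NegzE mulrNz mulNrn pmulrn.
by exists (l' ++ l); rewrite raddfD raddfMz /= IH tens_sum_cat -Hl'.
Qed.

(* The universal property of the tensor product, for a map that is balanced    *)
(* only modulo the subgroup P.                                                 *)
Lemma tens_sum_eq0 (G : zmodType) (P : G -> Prop) (phi : A -> M -> G)
    (l : seq (A * M)) :
  P 0 -> (forall g h, P g -> P h -> P (g - h)) ->
  (forall a b x, P (phi (a + b) x - phi a x - phi b x)) ->
  (forall a x y, P (phi a (x + y) - phi a x - phi a y)) ->
  (forall a (r : R) x, P (phi ((r : R^c) *: a) x - phi a (r *: x))) ->
  tens_sum l = 0 -> P (\sum_(z <- l) phi z.1 z.2).
Proof.
move=> P0 PB PDl PDr PZ.
pose Phi (u : {freeg (A * M)%type}) : G :=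
  fglift (fun z => phi z.1 z.2 : zmodule G) u.
have PhiB u v : Phi (u - v) = Phi u - Phi v.
  exact: (@lift_is_additive _ _ (zmodule G)).
have PhiU a x : Phi << (a, x) >> = phi a x.
  by rewrite /Phi liftU scale1r.
have Phi0 : Phi 0 = 0 by rewrite -[0](subrr 0) PhiB subrr.
have PhiD u v : Phi (u + v) = Phi u + Phi v.
  by rewrite -[v in LHS]opprK PhiB -[- v]sub0r PhiB Phi0 sub0r opprK.
have PhiR u : tensor_rel u -> P (Phi u).
  elim=> [|v w _ vR _ wR|a b x|a x y|a r x].
  - by rewrite Phi0.
  - by rewrite PhiB; apply: PB.
  - by rewrite !PhiB !PhiU; apply: PDl.
  - by rewrite !PhiB !PhiU; apply: PDr.
  - by rewrite !PhiB !PhiU; apply: PZ.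
have -> : tens_sum l = to_tensor (\sum_(z <- l) << z >>).
  by rewrite raddf_sum; apply: eq_bigr => -[].
have -> : \sum_(z <- l) phi z.1 z.2 = Phi (\sum_(z <- l) << z >>).
  elim: l => [|[a x] l IH]; first by rewrite !big_nil Phi0.
  by rewrite !big_cons PhiD PhiU IH.
by move/to_tensor_eq0/PhiR.
Qed.

End TensorElements.

Lemma tensor_map_tens_sum (R : pzRingType) (A B : lmodType R^c)
    (M : lmodType R) (f : {linear A -> B}) (l : seq (A * M)) :
  tensor_map f (tens_sum l) = tens_sum [seq (f z.1, z.2) | z <- l].
Proof.
have map0 : tensor_map f (0 : tensor A M) = 0.
  by rewrite -[0](subrr 0) tensor_mapB subrr.
have mapD s t : tensor_map f (s + t : tensor A M) = tensor_map f s + tensor_map f t.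
  by rewrite -[t in LHS]opprK tensor_mapB -[- t]sub0r tensor_mapB map0 sub0r opprK.
rewrite /tens_sum big_map; elim: l => [|[a x] l IH]; first by rewrite !big_nil.
by rewrite !big_cons mapD tensor_map_tens IH.
Qed.

(** * The equational criterion for flatness *)

Section EquationalCriterion.
Variable R : pzRingType.

Definition lincomb (V : lmodType R) m n (A : 'M[R]_(m, n)) (x : 'I_n -> V)
  (i : 'I_m) : V := \sum_(j < n) A i j *: x j.

Lemma lincombB (V : lmodType R) m n (A : 'M[R]_(m, n)) (x y : 'I_n -> V) i :
  lincomb A (fun j => x j - y j) i = lincomb A x i - lincomb A y i.
Proof.
by rewrite /lincomb -sumrB; apply: eq_bigr => j _; rewrite scalerBr.
Qed.

Lemma lincomb_linear (V W : lmodType R) (g : {linear V -> W}) m n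
    (A : 'M[R]_(m, n)) (x : 'I_n -> V) i :
  g (lincomb A x i) = lincomb A (fun j => g (x j)) i.
Proof.
by rewrite linear_sum; apply: eq_bigr => j _; rewrite linearZ.
Qed.

(* The image of ker A (x) V in V^n, where A acts on columns.                   *)
Definition ker_span (V : lmodType R) m n (A : 'M[R]_(m, n)) (x : 'I_n -> V) :
  Prop :=
  exists l : seq ('cV[R]_n * V),
    (forall p, p \in l -> A *m p.1 = 0) /\
    forall j, x j = \sum_(p <- l) p.1 j 0 *: p.2.

Section KerSpan.
Variables (V : lmodType R) (m n : nat) (A : 'M[R]_(m, n)).

Lemma ker_span0 : ker_span A (fun=> 0 : V).
Proof. by exists [::]; split=> // j; rewrite big_nil. Qed.

Lemma ker_span1 (d : 'cV[R]_n) (y : V) :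
  A *m d = 0 -> ker_span A (fun j => d j 0 *: y).
Proof.
move=> Ad; exists [:: (d, y)]; split=> [p|j]; last by rewrite big_seq1.
by rewrite inE => /eqP ->.
Qed.

Lemma ker_spanD (x y : 'I_n -> V) :
  ker_span A x -> ker_span A y -> ker_span A (fun j => x j + y j).
Proof.
move=> [l [Al xl]] [k [Ak yk]]; exists (l ++ k); split=> [p|j].
  by rewrite mem_cat => /orP[/Al|/Ak].
by rewrite big_cat xl yk.
Qed.

Lemma ker_span_linear (W : lmodType R) (g : {linear V -> W}) (x : 'I_n -> V) :
  ker_span A x -> ker_span A (fun j => g (x j)).
Proof.
move=> [l [Al xl]]; exists [seq (p.1, g p.2) | p <- l]; split=> [p|j].
  by move=> /mapP[q /Al Aq ->].
by rewrite xl linear_sum big_map; apply: eq_bigr => p _; rewrite linearZ.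
Qed.

Lemma eq_ker_span (x y : 'I_n -> V) : x =1 y -> ker_span A x -> ker_span A y.
Proof. by move=> xy [l [Al xl]]; exists l; split=> // j; rewrite -xy xl. Qed.

Lemma ker_spanB (x y : 'I_n -> V) :
  ker_span A x -> ker_span A y -> ker_span A (fun j => x j - y j).
Proof.
by move=> xA /(ker_span_linear (-%R : {linear V -> V})); apply: ker_spanD.
Qed.

Lemma ker_span_sum (I : Type) (r : seq I) (F : I -> 'I_n -> V) :
  (forall i, ker_span A (F i)) -> ker_span A (fun j => \sum_(i <- r) F i j).
Proof.
move=> FA; elim: r => [|i r IH].
  by apply: eq_ker_span ker_span0 => j; rewrite big_nil.
by apply: eq_ker_span (ker_spanD (FA i) IH) => j; rewrite big_cons.
Qed.

Lemma ker_span_factor (x : 'I_n -> V) : ker_span A x ->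
  exists k (D : 'M[R]_(n, k)) (y : 'I_k -> V),
    A *m D = 0 /\ forall j, x j = \sum_(i < k) D j i *: y i.
Proof.
move=> [l [Al xl]].
exists (size l), (\matrix_(j, i) (tnth (in_tuple l) i).1 j 0),
  (fun i => (tnth (in_tuple l) i).2); split=> [|j]; last first.
  by rewrite xl big_tnth; apply: eq_bigr => i _; rewrite mxE.
apply/matrixP=> i j; have /Al/matrixP/(_ i 0) := mem_tnth j (in_tuple l).
by rewrite !mxE => E; rewrite -[RHS]E; apply: eq_bigr => s _; rewrite !mxE.
Qed.

End KerSpan.

Definition eq_flat (M : lmodType R) : Prop :=
  forall m n (A : 'M[R]_(m, n)) (x : 'I_n -> M),
    (forall i, lincomb A x i = 0) -> ker_span A x.

(** A solution in [R] is itself a column of the kernel of [A], multiplied by the vector 1. *)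
Lemma eq_flat_regular : eq_flat R^o.
Proof.
move=> m n A x Ax.
have Ad : A *m (\col_j x j) = 0.
  apply/matrixP=> i j; rewrite !mxE -[RHS](Ax i).
  by apply: eq_bigr => k _; rewrite mxE.
apply: eq_ker_span (@ker_span1 R^o _ _ _ _ 1 Ad) => j.
by rewrite mxE [_ *: _]mulr1.
Qed.

(** Finitely many elements and finitely many formal relations of [M] form a single system: the
    elements are the unknowns, the relations the rows. The criterion writes the elements over new
    vectors [y] with coefficients that themselves obey the relations. *)
Lemma eq_flat_lift (M : lmodType R) (s : seq M) (T : seq (seq (R * M))) :
  eq_flat M -> (forall rel, rel \in T -> \sum_(p <- rel) p.1 *: p.2 = 0) ->
  exists k (y : 'I_k -> M) (c : 'I_k -> M -> R),
    (forall x, x \in s -> x = \sum_(i < k) c i x *: y i) /\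
    forall i rel, rel \in T -> \sum_(p <- rel) p.1 * c i p.2 = 0.
Proof.
move=> flatM T0.
(* An element repeated in [s'] is always charged to its first index, so equal elements get equal
   coefficients. *)
pose s' := s ++ flatten [seq unzip2 rel | rel <- T].
pose n := size s'.
pose A : 'M[R]_(size T, n) :=
  \matrix_(i, j) \sum_(p <- nth [::] T i | index p.2 s' == j) p.1.
have pick (W : zmodType) (F : 'I_n -> W) x (xs : x \in s') :
    \sum_(j < n | index x s' == j) F j = F (Ordinal (etrans (index_mem x s') xs)).
  by apply: big_pred1 => j; rewrite eq_sym /=.
have Tmem rel p : rel \in T -> p \in rel -> p.2 \in s'.
  move=> relT prel; rewrite mem_cat; apply/orP; right; apply/flatten_mapP.
  by exists rel => //; apply: map_f.
have [|k [D [y [AD xD]]]] :=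
    ker_span_factor (flatM _ _ A (fun j : 'I_n => nth 0 s' j) _).
  move=> i; rewrite /lincomb.
  have relT : nth [::] T i \in T by rewrite mem_nth.
  under eq_bigr => j _ do rewrite mxE scaler_suml big_mkcond.
  rewrite exchange_big /= -[RHS](T0 _ relT); apply: eq_big_seq => p prel.
  by rewrite -big_mkcond pick ?(Tmem _ _ relT) //= => ps; rewrite nth_index.
exists k, y, (fun i x => \sum_(j < n | index x s' == j) D j i); split.
  move=> x xs; have xs' : x \in s' by rewrite mem_cat xs.
  under eq_bigr => i _ do rewrite pick.
  by rewrite -xD /= nth_index.
move=> i rel relT.
have idx : (index rel T < size T)%N by rewrite index_mem.
have /matrixP/(_ (Ordinal idx) i) := AD; rewrite !mxE => E.
rewrite -[RHS]E; under [RHS]eq_bigr => j _ do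
  rewrite mxE /= nth_index // big_distrl big_mkcond.
rewrite exchange_big /=; apply: eq_bigr => p _.
by rewrite big_distrr big_mkcond.
Qed.

(** A vanishing sum in the tensor product with [B] uses only finitely many relations [T] of [M]. Any
    [c : M -> R] obeying [T] then sends it to zero in [B]. Applied to the coefficients from
    [eq_flat_lift], and cancelling the injective [f], this makes the sum vanish already over [A]. *)
Lemma eq_flat_flat (M : lmodType R) : eq_flat M -> flat M.
Proof.
move=> flatM A B f f_inj s t Est.
suff tens_inj u : tensor_map f u = 0 :> tensor B M -> u = 0.
  by apply/eqP; rewrite -subr_eq0; apply/eqP/tens_inj; rewrite tensor_mapB Est subrr.
have [l ->] := tensor_tens_sum u; rewrite tensor_map_tens_sum => fl0.
pose P (g : (M -> R) -> B) := exists T : seq (seq (R * M)),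
  (forall rel, rel \in T -> \sum_(p <- rel) p.1 *: p.2 = 0) /\
  forall c : M -> R,
    (forall rel, rel \in T -> \sum_(p <- rel) p.1 * c p.2 = 0) -> g c = 0.
pose phi (b : B) (x : M) : (M -> R) -> B := fun c => (c x : R^c) *: b.
have [||||| T [T0 Tl]] := @tens_sum_eq0 R B M ((M -> R) -> B) P phi _ _ _ _ _ _ fl0.
- by exists [::].
- move=> g h [T [T0 gT]] [U [U0 hU]]; exists (T ++ U); split=> [rel|c Hc].
    by rewrite mem_cat => /orP[/T0|/U0].
  have -> : (g - h) c = g c - h c by [].
  by rewrite gT ?hU ?subrr // => rel relT; apply: Hc; rewrite mem_cat relT ?orbT.
- move=> a b x; exists [::]; split=> // c _.
  have -> : (phi (a + b) x - phi a x - phi b x) c =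
    phi (a + b) x c - phi a x c - phi b x c by [].
  by rewrite /phi scalerDr addrAC addrK subrr.
- move=> a x y; exists [:: [:: (1, x + y); (-1, x); (-1, y)]]; split=> [rel|c Hc].
    rewrite inE => /eqP ->; rewrite !big_cons big_nil /= !scaleN1r scale1r addr0.
    by rewrite -opprD subrr.
  have := Hc _ (mem_head _ _); rewrite !big_cons big_nil /= !mulN1r mul1r addr0.
  have -> : (phi a (x + y) - phi a x - phi a y) c =
    phi a (x + y) c - phi a x c - phi a y c by [].
  by rewrite /phi -!scalerBl addrA => ->; rewrite scale0r.
- move=> a r x; exists [:: [:: (1, r *: x); (- r, x)]]; split=> [rel|c Hc].
    by rewrite inE => /eqP ->; rewrite !big_cons big_nil /= scale1r scaleNr addr0 subrr.
  have := Hc _ (mem_head _ _); rewrite !big_cons big_nil /= mul1r addr0 mulNr.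
  have -> : (phi ((r : R^c) *: a) x - phi a (r *: x)) c =
    phi ((r : R^c) *: a) x c - phi a (r *: x) c by [].
  move/eqP; rewrite subr_eq0 => /eqP E; rewrite /phi E scalerA; apply/eqP.
  by rewrite subr_eq0.
have [k [y [c [lc cT]]]] := eq_flat_lift (unzip2 l) flatM T0.
have fc0 i : \sum_(z <- l) (c i z.2 : R^c) *: z.1 = 0.
  apply: f_inj; rewrite linear0 linear_sum -[RHS](Tl (c i) (cT i)).
  have -> (r : seq (B * M)) : (\sum_(z <- r) phi z.1 z.2) (c i) =
      \sum_(z <- r) phi z.1 z.2 (c i).
    elim: r => [|z r IH]; first by rewrite !big_nil.
    by rewrite !big_cons -IH.
  by rewrite big_map; apply: eq_bigr => z _; rewrite linearZ.
rewrite /tens_sum (eq_big_seq (fun z => \sum_(i < k) tens ((c i z.2 : R^c) *: z.1) (y i))).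
  rewrite exchange_big big1 //= => i _.
  by rewrite -tens_suml fc0 tens0l.
move=> z zl; rewrite [in LHS](lc z.2) ?map_f // tens_sumr.
by apply: eq_bigr => i _; rewrite tensZ.
Qed.

End EquationalCriterion.

Section ImageSubmodule.
Variables (R : pzRingType) (V W : lmodType R) (f : {linear V -> W}).

Lemma image_submod0 : exists x, f x = 0.
Proof. by exists 0; rewrite linear0. Qed.

Lemma image_submodZD a y z :
  (exists x, f x = y) -> (exists x, f x = z) -> exists x, f x = a *: y + z.
Proof. by move=> [x <-] [x' <-]; exists (a *: x + x'); rewrite linearP. Qed.

Definition image_submod : submodule W := Submodule image_submod0 image_submodZD.

Lemma to_image_subproof x : submodb image_submod (f x).
Proof. by apply/asboolP; exists x. Qed.

Definition to_image (x : V) : submod_type image_submod :=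
  SubmodType (to_image_subproof x).

Lemma to_image_linear : linear to_image.
Proof. by move=> a x y; apply: val_inj; rewrite linearP /= linearP. Qed.

HB.instance Definition _ :=
  GRing.isLinear.Build R V (submod_type image_submod) _ to_image
    to_image_linear.

Lemma to_image_surj u : exists x, to_image x = u.
Proof. by have /asboolP[x fx] := valP u; exists x; apply: val_inj. Qed.

End ImageSubmodule.

(* Flatness makes I (x) M -> R^m (x) M injective, where I is the image of A    *)
(* acting on columns; the relations of I (x) M then only see ker A.            *)
Lemma flat_eq_flat (R : pzRingType) (M : lmodType R) : flat M -> eq_flat M.
Proof.
move=> flatM m n A x Ax.
(* Columns over [R] form a right module, so they become rows over the opposite ring and [A] is
   transposed. *)
pose At : 'M[R^c]_(n, m) := \matrix_(j, i) A i j.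
pose f : {linear 'rV[R^c]_n -> 'rV[R^c]_m} := mulmxr At.
pose I := submod_type (image_submod f).
pose incl : {linear I -> 'rV[R^c]_m} := \val.
have incl_inj : injective incl by exact: val_inj.
pose e (j : 'I_n) : 'rV[R^c]_n := delta_mx 0 j.
pose l : seq (I * M) := [seq (to_image f (e j), x j) | j <- index_enum 'I_n].
have l0 : tens_sum l = 0.
  apply: (flatM _ _ _ incl_inj).
  have -> : tensor_map incl (0 : tensor I M) = 0.
    by rewrite -[0](subrr 0) tensor_mapB subrr.
  transitivity (\sum_(j < n) tens (f (e j)) (x j)).
    by rewrite tensor_map_tens_sum /tens_sum -map_comp big_map.
  have fe j : f (e j) = \sum_(i < m) (A i j : R^c) *: delta_mx 0 i.
    rewrite /f /= /e -rowE [LHS]row_sum_delta.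
    by apply: eq_bigr => i _; rewrite !mxE.
  under eq_bigr => j _ do rewrite fe tens_suml.
  rewrite exchange_big big1 //= => i _.
  under eq_bigr => j _ do rewrite tensZ.
  by rewrite -tens_sumr -/(lincomb A x i) Ax tens0r.
(* The section [s] is not linear, so [phi] is balanced only up to [ker f]; by [kerP] the errors stay
   in [ker_span A]. *)
pose s (u : I) : 'rV[R^c]_n := sval (cid (to_image_surj u)).
have sK u : to_image f (s u) = u by exact: svalP (cid (to_image_surj u)).
pose phi (u : I) (y : M) : 'I_n -> M := fun j => (s u 0 j : R) *: y.
have kerP (v : 'rV[R^c]_n) (y : M) :
    to_image f v = 0 -> ker_span A (fun j => (v 0 j : R) *: y).
  move=> fv; pose d : 'cV[R]_n := \col_j (v 0 j : R).
  have Ad : A *m d = 0.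
    have fv0 : f v = 0 by have := congr1 val fv.
    apply/matrixP=> i j; have /matrixP/(_ 0 i) := fv0.
    by rewrite !mxE => E; rewrite -[RHS]E; apply: eq_bigr => k _; rewrite !mxE.
  by apply: eq_ker_span (ker_span1 y Ad) => j; rewrite mxE.
have S0 : ker_span A (\sum_(z <- l) phi z.1 z.2).
  apply: (@tens_sum_eq0 R I M ('I_n -> M) (@ker_span R M m n A) phi l _ _ _ _ _ l0).
  - exact: ker_span0.
  - by move=> g h; apply: ker_spanB.
  - move=> a b y; apply: eq_ker_span (kerP (s (a + b) - s a - s b) y _) => [j|].
      by rewrite !mxE !scalerBl.
    by rewrite !linearB /= !sK addrAC addrK subrr.
  - move=> a y z; apply: eq_ker_span (@ker_span0 R M m n A) => j.
    have -> : (phi a (y + z) - phi a y - phi a z) j =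
      phi a (y + z) j - phi a y j - phi a z j by [].
    by rewrite /phi scalerDr addrAC addrK subrr.
  - move=> a r y; apply: eq_ker_span (kerP (s ((r : R^c) *: a) - (r : R^c) *: s a) y _) => [j|].
      rewrite !mxE scalerBl.
      have -> : (phi ((r : R^c) *: a) y - phi a (r *: y)) j =
        phi ((r : R^c) *: a) y j - phi a (r *: y) j by [].
      by rewrite /phi scalerA.
    by rewrite linearB linearZ /= !sK subrr.
(* [s] need not return [e k], but it differs from it by a kernel vector; adding these corrections to
   [S0] recovers [x]. *)
have S1 : ker_span A (fun j =>
    \sum_(k < n) ((e k - s (to_image f (e k))) 0 j : R) *: x k).
  apply: (@ker_span_sum _ _ _ _ _ _ _ (fun k j =>
    ((e k - s (to_image f (e k))) 0 j : R) *: x k)) => k.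
  by apply: kerP; rewrite linearB /= sK subrr.
apply: eq_ker_span (ker_spanD S1 S0) => j; rewrite big_map.
have -> (F : 'I_n -> 'I_n -> M) : (\sum_(k < n) F k) j = \sum_(k < n) F k j.
  by elim/big_rec2: _ => // k ? ? _ <-.
rewrite -big_split /= (bigD1 j) //= big1 ?addr0.
  by rewrite !mxE !eqxx /phi -scalerDl subrK scale1r.
move=> k kj; rewrite !mxE /phi -scalerDl subrK.
by rewrite eq_sym (negbTE kj) andbF scale0r.
Qed.

(** * Pure submodules *)

Section Purity.
Variable R : pzRingType.

Definition pure (F : lmodType R) (K : submodule F) : Prop :=
  forall m n (A : 'M[R]_(m, n)) (x : 'I_n -> F),
    (forall i, K (lincomb A x i)) ->
    exists k : 'I_n -> F,
      (forall j, K (k j)) /\ forall i, lincomb A k i = lincomb A x i.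

(* The equational criterion for V / K, stated on representatives.              *)
Definition eq_flat_mod (V : lmodType R) (K : submodule V) : Prop :=
  forall m n (A : 'M[R]_(m, n)) (x : 'I_n -> V),
    (forall i, K (lincomb A x i)) ->
    exists x' : 'I_n -> V, ker_span A x' /\ forall j, K (x j - x' j).

Lemma eq_flat_quot (V : lmodType R) (K : submodule V) :
  eq_flat_mod K -> eq_flat (quotmod K).
Proof.
move=> flatK m n A u Au; pose x j : V := repr (u j).
have xu j : to_quot K (x j) = u j by exact: to_quotK.
have Ax i : K (lincomb A x i).
  rewrite -[lincomb A x i]subr0; apply/to_quot_eq; rewrite linear0 -[RHS](Au i).
  by rewrite lincomb_linear; apply: eq_bigr => j _ /=; rewrite xu.
have [x' [Ax' xx']] := flatK _ _ _ _ Ax.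
apply: eq_ker_span (ker_span_linear (to_quot K) Ax') => j.
by apply/esym; rewrite -xu; apply/to_quot_eq.
Qed.

(** Subtracting the solution that purity provides inside [K] leaves a homogeneous solution in
    [F]. *)
Lemma pure_eq_flat_mod (F : lmodType R) (K : submodule F) :
  eq_flat F -> pure K -> eq_flat_mod K.
Proof.
move=> flatF pureK m n A x Ax; have [k [Kk Ak]] := pureK _ _ _ _ Ax.
exists (fun j => x j - k j); split=> [|j]; last by rewrite opprB addrC subrK.
by apply: flatF => i; rewrite lincombB Ak subrr.
Qed.

Section Preimage.
Variables (V F : lmodType R) (g : {linear V -> F}) (K : submodule F).

Lemma preim_submod0 : K (g 0).
Proof. by rewrite linear0; apply: submod0. Qed.

Lemma preim_submodZD a x y : K (g x) -> K (g y) -> K (g (a *: x + y)).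
Proof. by rewrite linearP; apply: submodZD. Qed.

Definition preim_submod : submodule V :=
  @Submodule R V (fun v => K (g v)) preim_submod0 preim_submodZD.

(** As [g] is onto modulo [K], it identifies the quotient of [V] by the preimage with [F / K]; the
    vectors of a kernel expression are lifted one by one. *)
Lemma eq_flat_mod_preim :
  (forall y, exists v, K (g v - y)) -> eq_flat_mod K -> eq_flat_mod preim_submod.
Proof.
move=> g_surj flatK m n A x Ax.
have [|x' [[l [Al xl]] xx']] := flatK _ _ A (fun j => g (x j)).
  by move=> i; rewrite -lincomb_linear; apply: Ax.
pose s y : V := sval (cid (g_surj y)).
have sK y : K (g (s y) - y) by exact: svalP (cid (g_surj y)).
exists (fun j => \sum_(p <- l) p.1 j 0 *: s p.2); split=> [|j].
  exists [seq (p.1, s p.2) | p <- l]; split=> [p /mapP[q /Al Aq -> //]|j].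
  by rewrite big_map.
rewrite /preim_submod /= linearB linear_sum /=.
rewrite -[g (x j)](subrK (x' j)) -addrA; apply: submodD => //.
rewrite xl -sumrB; apply: submod_sum => p _.
by rewrite linearZ -scalerBr -opprB; apply/submodZ/submodN.
Qed.

End Preimage.

Section ChainUnion.
Variables (F : lmodType R) (C : set (set F)).
Hypothesis Csub : forall A, C A -> A !=set0 ->
  exists2 K : submodule F, pure K & forall x, K x <-> A x.
Hypothesis Ctotal : total_on C subset.

Let U : set F := \bigcup_(A in C) A.

Lemma chain_finite n (x : 'I_n.+1 -> F) : (forall i, U (x i)) ->
  exists2 A, C A & forall i, A (x i).
Proof.
elim: n x => [|n IH] x Ux.
  by have [A CA Ax] := Ux ord0; exists A => // i; rewrite ord1.
have [A CA Ax] := IH (fun i => x (fintype.lift ord0 i)) (fun i => Ux (fintype.lift ord0 i)).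
have [B CB Bx] := Ux ord0.
have [AB|BA] := Ctotal CA CB.
  exists B => // i; case: (unliftP ord0 i) => [j ->|->//]; exact: AB.
by exists A => // i; case: (unliftP ord0 i) => [j ->|->] //; apply: BA.
Qed.

(** A system has finitely many rows, so its right-hand sides lie in one member of the chain, whose
    purity solves it. *)
Lemma chain_union_pure :
  U !=set0 -> exists2 K : submodule F, pure K & forall x, K x <-> U x.
Proof.
move=> [x0 [A0 CA0 A0x]].
have [K0 _ KA0] := Csub CA0 (ex_intro _ x0 A0x).
have U0 : U 0 by exists A0 => //; apply/KA0/submod0.
have UZD a x y : U x -> U y -> U (a *: x + y).
  move=> Ux Uy; have [|A CA Axy] := @chain_finite 1 (fun i => if i == ord0 then x else y).
    by move=> i; case: ifP.
  have [Ax Ay] : A x /\ A y by split; [exact: (Axy ord0)|exact: (Axy ord_max)].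
  have [K _ KA] := Csub CA (ex_intro _ x Ax).
  by exists A => //; apply/KA/submodZD; apply/KA.
exists (@Submodule R F U U0 UZD) => // m n A x /= UAx.
(* Without rows there is no element from which to select a member of the chain, and zero is a
   solution. *)
case: m A UAx => [|m] A UAx.
  by exists (fun=> 0); split=> // -[].
have [B CB BAx] := chain_finite UAx.
have [K pureK KB] := Csub CB (ex_intro _ _ (BAx ord0)).
have [|k [Kk Ak]] := pureK _ _ A x; first by move=> i; apply/KB.
by exists k; split=> // j; exists B => //; apply/KB.
Qed.

End ChainUnion.

Lemma zero_submodZD (F : lmodType R) (a : R) (x y : F) :
  x = 0 -> y = 0 -> a *: x + y = 0.
Proof. by move=> -> ->; rewrite scaler0 addr0. Qed.

Definition zero_submod (F : lmodType R) : submodule F :=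
  @Submodule R F (fun x => x = 0) erefl (@zero_submodZD F).

Lemma zero_submod_pure (F : lmodType R) : pure (zero_submod F).
Proof.
move=> m n A x Ax; exists (fun=> 0); split=> // i; rewrite [RHS]Ax.
by rewrite /lincomb big1 // => j _; rewrite scaler0.
Qed.

Lemma exists_maximal_pure (F N : lmodType R) (f : {linear F -> N}) :
  exists K : submodule F, [/\ pure K, forall x, K x -> f x = 0 &
    forall L : submodule F, pure L -> (forall x, L x -> f x = 0) ->
      (forall x, K x -> L x) -> forall x, L x -> K x].
Proof.
(* Zorn's lemma also tests the empty chain, whose union is empty and no submodule; hence the guard.
   A maximal set is nonempty because [[set 0]] would exceed it. *)
pose P (A : set F) := A !=set0 ->
  (exists2 K : submodule F, pure K & forall x, K x <-> A x) /\
  forall x, A x -> f x = 0.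
have [C CP Ctot|A [PA Amax]] := @Zorn_bigcup F P.
  move=> U0; split=> [|x [A CA Ax]].
    by apply: chain_union_pure => // A CA A0; have [] := CP _ CA A0.
  by have [|_] := CP _ CA; [exists x|apply].
have A0 : A !=set0.
  apply: contrapT => /set0P/negP/negPn/eqP AE; apply: (Amax [set 0]).
    by rewrite AE; split=> // /(_ 0 erefl).
  move=> _; split=> [|x ->]; last exact: linear0.
  by exists (zero_submod F) => //; apply: zero_submod_pure.
have [[K pureK KA] fA] := PA A0; exists K; split=> // [x /KA /fA //|L pureL fL KL].
apply: contrapT => /existsNP[x /not_implyP[Lx nKx]]; apply: (Amax (L : set F)).
  by split=> [y /KA /KL //|LA]; apply/nKx/KA/LA.
by move=> _; split=> //; exists L.
Qed.

End Purity.

(** * Terms and the bound on flat factors *)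

Inductive term (R : pzRingType) :=
  | TVar
  | TComb (a : R) (t u : term R)
  | TSol m n (A : 'M[R]_(m, n)) (ts : 'I_m -> term R) (j : 'I_n).
Arguments TVar {R}.

Section SmallFactor.
Variables (R : pzRingType) (F : lmodType R) (K : submodule F).

Section Solve.
Variables (m n : nat) (A : 'M[R]_(m, n)) (u : 'I_m -> F -> F).

Definition solves (z : 'I_n -> F) (x y : F) : Prop :=
  forall i, K (lincomb A z i - (u i x - u i y)).

Definition solvable (x y : F) : Prop := exists z, solves z x y.

(** The common reference point [w] cancels in the difference. *)
Lemma solvesB z z' x y w : solves z x w -> solves z' y w ->
  solves (fun j => z j - z' j) x y.
Proof.
move=> zxw zyw i; rewrite lincombB.
have -> : lincomb A z i - lincomb A z' i - (u i x - u i y) =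
  (lincomb A z i - (u i x - u i w)) - (lincomb A z' i - (u i y - u i w)).
  have -> : u i x - u i y = (u i x - u i w) - (u i y - u i w).
    by rewrite opprB addrA subrK.
  move: (u i x - _) (u i y - _) => a b.
  by rewrite !opprB addrACA [RHS]addrACA; congr (_ + _); rewrite addrC.
exact: submodB.
Qed.

Lemma solves0 x : solves (fun=> 0) x x.
Proof.
move=> i; rewrite /lincomb big1 => [|j _]; last by rewrite scaler0.
by rewrite !subrr; apply: submod0.
Qed.

Lemma solvable_trans x y w : solvable x w -> solvable y w -> solvable x y.
Proof. by move=> [z zs] [z' zs']; exists (fun j => z j - z' j); apply: solvesB zs'. Qed.

Lemma solvable_sym x y : solvable x y -> solvable y x.
Proof. by apply: solvable_trans; exists (fun=> 0); apply: solves0. Qed.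

(* Solvability of A z = u(x) - u(y) modulo K is an equivalence of x and y;     *)
(* comparing every x with the chosen representative of its class gives, for    *)
(* each x separately, a solution whose differences solve all solvable systems. *)
Definition base (x : F) : F := xget 0 [set w | solvable x w].

Definition sol (x : F) : 'I_n -> F := xget (fun=> 0) [set z | solves z x (base x)].

Lemma solP x y : solvable x y -> solves (fun j => sol x j - sol y j) x y.
Proof.
move=> xy.
have bx w : solves (sol w) w (base w).
  have [z zs] : solvable w (base w).
    by apply: (@xgetPex _ 0 [set v | solvable w v]); exists w, (fun=> 0); apply: solves0.
  by apply: (@xgetPex _ (fun=> 0) [set v | solves v w (base w)]); exists z.
have bxy : base x = base y.
  congr xget; apply/seteqP; split=> w /= ws.
    by apply: solvable_trans (solvable_sym ws); apply: solvable_sym.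
  by apply: solvable_trans (solvable_sym ws).
by apply: solvesB (bx y); rewrite -bxy.
Qed.

End Solve.

Fixpoint eval (t : term R) : F -> F :=
  match t with
  | TVar => id
  | TComb a t u => fun x => a *: eval t x + eval u x
  | TSol m n A ts j => fun x => sol A (fun i => eval (ts i)) x j
  end.

Section Difference.
Variables x y : F.

Definition difference (z : F) : Prop := exists t, K (z - (eval t x - eval t y)).

Lemma difference_submod_sub z : K z -> difference z.
Proof.
(* This term evaluates to zero everywhere. *)
move=> Kz; exists (TComb (-1) TVar TVar).
by rewrite /= !scaleN1r !addNr !subr0.
Qed.

Lemma differenceZD a z w :
  difference z -> difference w -> difference (a *: z + w).
Proof.
move=> [t Kt] [u Ku]; exists (TComb a t u) => /=.
have -> : a *: eval t x + eval u x - (a *: eval t y + eval u y) =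
    a *: (eval t x - eval t y) + (eval u x - eval u y).
  by rewrite opprD addrACA scalerBr.
rewrite opprD addrACA -scalerBr.
exact: submodZD.
Qed.

Definition difference_submod : submodule F :=
  Submodule (difference_submod_sub (submod0 K)) differenceZD.

(** The terms [TSol A ts j] solve the system only modulo [K]. The combinations of the error [x0 - k]
    lie in [K], so purity of [K] supplies an exact correction [h] with entries in [K]. *)
Lemma difference_pure : pure K -> pure difference_submod.
Proof.
move=> pureK m n A x0 /choice[ts Kts].
have /solP sols : solvable A (fun i => eval (ts i)) x y by exists x0.
pose k j := eval (TSol A ts j) x - eval (TSol A ts j) y.
have [|h [Kh Ah]] := pureK _ _ A (fun j => x0 j - k j).
  move=> i; have [D Kx0 Kk] : exists2 D, K (lincomb A x0 i - D) & K (lincomb A k i - D).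
    by exists (eval (ts i) x - eval (ts i) y); [exact: Kts|exact: sols].
  by rewrite lincombB -[lincomb A x0 i](subrK D) -addrA -[D - _]opprB; apply: submodB.
exists (fun j => h j - (- k j)); split=> [j|i].
  exists (TSol A ts j); rewrite opprK -/(k j) addrK; exact: Kh.
rewrite lincombB Ah lincombB.
have -> : lincomb A (fun j => - k j) i = - lincomb A k i.
  by rewrite /lincomb -sumrN; apply: eq_bigr => j _; rewrite scalerN.
by rewrite opprK subrK.
Qed.

End Difference.
End SmallFactor.

(** [c x = c y] says that [f] kills [difference_submod K x y], which maximality then forces into
    [K]. *)
Lemma small_flat_factor (R : pzRingType) (F N : lmodType R) (f : {linear F -> N}) :
  eq_flat F ->
  exists (K : submodule F) (c : F -> term R -> N),
    [/\ eq_flat_mod K, forall x, K x -> f x = 0 &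
        forall x y, c x = c y -> K (x - y)].
Proof.
move=> flatF; have [K [pureK fK maxK]] := exists_maximal_pure f.
exists K, (fun x t => f (eval K t x)); split=> //; first exact: pure_eq_flat_mod.
move=> x y cxy; apply: (maxK (difference_submod K x y)).
- exact: difference_pure.
- move=> z [t /fK]; rewrite !linearB /=.
  by have -> : f (eval K t x) = f (eval K t y) := congr1 (@^~ t) cxy; rewrite subrr addr0.
- by move=> z; apply: difference_submod_sub.
by exists TVar; rewrite subrr; apply: submod0.
Qed.

(** * Existence of flat precovers *)

Section LinearOf.
Variables (R : pzRingType) (U V : lmodType R) (f : U -> V) (f_lin : linear f).

Definition linear_of (_ : linear f) : U -> V := f.

HB.instance Definition _ := GRing.isLinear.Build R U V _ (linear_of f_lin) f_lin.

Definition linear_pack : {linear U -> V} := linear_of f_lin.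

End LinearOf.

Lemma quot_factor (R : pzRingType) (V N : lmodType R) (K : submodule V)
    (H : {linear V -> N}) : (forall x, K x -> H x = 0) ->
  exists g : {linear quotmod K -> N}, forall x, g (to_quot K x) = H x.
Proof.
move=> HK.
have repr_eq x : H (repr (to_quot K x)) = H x.
  apply/eqP; rewrite -subr_eq0 -linearB; apply/eqP/HK/to_quot_eq.
  exact: to_quotK.
have lin : linear (fun u : quotmod K => H (repr u)).
  move=> a u v; rewrite -[u in LHS]to_quotK -[v in LHS]to_quotK -linearP.
  by rewrite repr_eq linearP.
by exists (linear_pack lin).
Qed.

Section FlatPrecover.
Variables (R : pzRingType) (N : lmodType R).

Let X : choiceType := (term R -> N)%type.
Let V := free R X.

(* A flat module over N small enough to embed into X is coded as a quotient of *)
(* the free module on X, so that these modules form a set.                     *)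
Record small_flat := SmallFlat {
  sf_ker : submodule V;
  sf_map : X -> N;
  sf_map_ker : forall v, sf_ker v -> free_ext sf_map v = 0;
  sf_flat : eq_flat_mod sf_ker
}.

Let I : choiceType := {classic small_flat}.
(** This is the direct sum of copies of [V] indexed by [I], with projections [component] and
    injections [inject]. *)
Let W := free R (I * X)%type.

Definition component (i : I) : {linear W -> V} :=
  free_ext (fun p : I * X => if p.1 == i then dirac R p.2 else 0).

Definition inject (i : I) : {linear V -> W} :=
  free_ext (fun x => dirac R (i, x)).

Definition precover_map : {linear W -> N} :=
  free_ext (fun p : I * X => sf_map p.1 p.2).

Lemma component_inject i v : component i (inject i v) = v.
Proof.
apply: (@free_linear_eq _ _ _ (component i \o inject i) idfun) => x /=.
by rewrite /inject free_ext_dirac free_ext_dirac /= eqxx.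
Qed.

Lemma component_inject_neq i j v : i != j -> component j (inject i v) = 0.
Proof.
move=> ij.
apply: (@free_linear_eq _ _ _ (component j \o inject i) \0) => x /=.
by rewrite /inject free_ext_dirac free_ext_dirac /= (negbTE ij).
Qed.

Lemma precover_map_inject i v :
  precover_map (inject i v) = free_ext (sf_map i) v.
Proof.
apply: (@free_linear_eq _ _ _ (precover_map \o inject i)) => x /=.
by rewrite /inject !free_ext_dirac.
Qed.

Lemma component_decomp (w : W) (S : seq I) :
  uniq S -> {subset unzip1 (supp w) <= S} ->
  w = \sum_(i <- S) inject i (component i w).
Proof.
move=> Suniq wS.
have E i : inject i (component i w) =
    \sum_(p <- supp w) coef w p *: inject i (component i (dirac R p)).
  rewrite [in LHS](free_decomp w) (linear_sum (component i)) (linear_sum (inject i)).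
  by apply: eq_bigr => p _; rewrite !linearZ.
under eq_bigr => i _ do rewrite E.
rewrite [LHS]free_decomp exchange_big; apply: eq_big_seq => p pw /=.
rewrite -scaler_sumr (bigD1_seq p.1) ?wS ?map_f //= big1 ?addr0 => [|i ip].
  rewrite free_ext_dirac eqxx free_ext_dirac.
  by rewrite -surjective_pairing.
by rewrite free_ext_dirac eq_sym (negbTE ip) linear0.
Qed.

Lemma big_ker0 i : sf_ker i (component i 0).
Proof. by rewrite linear0; apply: submod0. Qed.

Lemma big_kerZD a v w :
  (forall i, sf_ker i (component i v)) -> (forall i, sf_ker i (component i w)) ->
  forall i, sf_ker i (component i (a *: v + w)).
Proof. by move=> Kv Kw i; rewrite linearP; apply: submodZD. Qed.

Definition big_ker : submodule W :=
  @Submodule R W (fun w => forall i, sf_ker i (component i w)) big_ker0 big_kerZD.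

Lemma big_ker_inject i v : sf_ker i v -> big_ker (inject i v).
Proof.
move=> Kv j; have [<-|ij] := eqVneq (i : I) j; first by rewrite component_inject.
by rewrite component_inject_neq //; apply: submod0.
Qed.

Lemma precover_map_ker w : big_ker w -> precover_map w = 0.
Proof.
move=> Kw; rewrite [w](component_decomp (undup_uniq (unzip1 (supp w)))).
  rewrite linear_sum big1 // => i _; rewrite /= precover_map_inject.
  exact: sf_map_ker.
by move=> i; rewrite mem_undup.
Qed.

(** [W / big_ker] is the direct sum of all coded flat quotients. A finite system meets only the
    finitely many summands in [S] and is treated in each separately. *)
Lemma eq_flat_mod_big_ker : eq_flat_mod big_ker.
Proof.
move=> m n A x Ax.
pose S : seq I := undup (flatten [seq unzip1 (supp (x j)) | j <- enum 'I_n]).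
have xS j : x j = \sum_(i <- S) inject i (component i (x j)).
  apply: component_decomp; first exact: undup_uniq.
  move=> i ix; rewrite mem_undup; apply/flatten_mapP.
  by exists j => //; rewrite mem_enum.
have /choice[y Hy] (i : I) : exists y : 'I_n -> V, ker_span A y /\
    forall j, sf_ker i (component i (x j) - y j).
  by apply: sf_flat => k; rewrite -lincomb_linear; apply: Ax.
exists (fun j => \sum_(i <- S) inject i (y i j)); split=> [|j].
  apply: (@ker_span_sum _ _ _ _ _ _ _ (fun i j => inject i (y i j))) => i.
  by apply: ker_span_linear; case: (Hy i).
rewrite [x j]xS -sumrB; apply: submod_sum => i _.
by rewrite -linearB; apply: big_ker_inject; case: (Hy i).
Qed.

Theorem exists_flat_precover :
  exists (F : lmodType R) (g : {linear F -> N}), flat_precover g.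
Proof.
have [g gE] := quot_factor precover_map_ker.
exists (quotmod big_ker), g; split.
  exact/eq_flat_flat/eq_flat_quot/eq_flat_mod_big_ker.
move=> F flatF f.
have [K [c [flatK fK cK]]] := small_flat_factor f (flat_eq_flat flatF).
(* The default 0 off the image of [c] is harmless: the code below takes the kernel induced by [G],
   whatever its values there. *)
pose s (t : X) : F := xget 0 [set x | c x = t].
have sK x : K (s (c x) - x).
  by apply: cK; apply: (@xgetPex _ 0 [set y | c y = c x]); exists x.
pose G : {linear V -> F} := free_ext s.
have Gc x : K (G (dirac R (c x)) - x) by rewrite /G /= free_ext_dirac.
have G_surj x : exists v, K (G v - x) by exists (dirac R (c x)).
have fG v : free_ext (fun t => f (s t)) v = f (G v).
  apply: (@free_linear_eq _ _ _ (free_ext (fun t => f (s t))) (f \o G)) => t.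
  by rewrite /= !free_ext_dirac.
have ker_map v : preim_submod G K v -> free_ext (fun t => f (s t)) v = 0.
  by move=> Kv; rewrite fG; apply: fK.
(* This codes [F / K] as a quotient of [V], with the map to [N] induced by [f]. *)
pose i : I := SmallFlat ker_map (eq_flat_mod_preim G_surj flatK).
(* Although [c] is not linear, [G] sends [dirac R (c x)] to [x] modulo [K], so [h] is linear. *)
pose h x : quotmod big_ker := to_quot big_ker (inject i (dirac R (c x))).
have h_lin : linear h.
  move=> a x y; rewrite /h -linearP -linearP; apply/to_quot_eq.
  rewrite -linearB; apply: big_ker_inject.
  rewrite /= /preim_submod /= linearB linearP /=.
  rewrite -[G (dirac R (c (a *: x + y)))](subrK (a *: x + y)) -addrA.
  apply: submodD; first exact: Gc.
  rewrite -opprB; apply: submodN; rewrite opprD addrACA -scalerBr.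
  by apply: submodZD; apply: Gc.
exists (linear_pack h_lin) => x.
rewrite [LHS]gE precover_map_inject /= fG.
by apply/eqP; rewrite -subr_eq0 -linearB; apply/eqP/fK.
Qed.

End FlatPrecover.

(** * Factorizations through free modules *)

Section Factorization.
Variable R : pzRingType.

Lemma row_ext_linear (M : lmodType R) n (e : 'I_n -> M) :
  linear (fun w : 'rV[R]_n => \sum_(i < n) w 0 i *: e i).
Proof.
move=> a v w; rewrite scaler_sumr -big_split; apply: eq_bigr => i _ /=.
by rewrite !mxE scalerDl scalerA.
Qed.

Definition row_ext (M : lmodType R) n (e : 'I_n -> M) : {linear 'rV[R]_n -> M} :=
  linear_pack (row_ext_linear e).

Lemma row_linear_eq (M : lmodType R) n (f : {linear 'rV[R]_n -> M}) w :
  f w = \sum_(i < n) w 0 i *: f (delta_mx 0 i).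
Proof.
rewrite [w in LHS]row_sum_delta linear_sum; apply: eq_bigr => i _.
by rewrite linearZ.
Qed.

(** The image of a finitely generated module is finitely generated, so the factorization of its
    inclusion is composed with the map onto it. With [Q] left open this serves both f-projective and
    Mittag-Leffler modules. *)
Lemma factors_through_image (Q : lmodType R -> Prop) (N : lmodType R) :
  (forall (S : pred N) (C : subLmodType S), finitely_generated C ->
    exists P : lmodType R, Q P /\ factors_through P (\val : {linear C -> N})) ->
  forall (M : lmodType R) (f : {linear M -> N}), finitely_generated M ->
    exists P : lmodType R, Q P /\ factors_through P f.
Proof.
move=> HQ M f [n [e eM]].
have [|P [QP [u [v uv]]]] := HQ _ (submod_type (image_submod f)).
  exists n, (fun i => to_image f (e i)) => y; have [x <-] := to_image_surj y.
  have [c ->] := eM x; exists c; rewrite linear_sum.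
  by apply: eq_bigr => i _; rewrite linearZ.
by exists P; split=> //; exists (u \o to_image f), v => x /=; rewrite uv.
Qed.

Lemma fg_free_row n : fg_free ('rV[R]_n : lmodType R).
Proof. by exists n, idfun; exists id. Qed.

Lemma fg_free_finitely_presented (P : lmodType R) :
  fg_free P -> finitely_presented P.
Proof.
move=> [n [f f_bij]]; exists 0%N, n, \0, f; split=> [y|v].
  by have [g _ fK] := f_bij; exists (g y).
split=> [fv|[w <-]]; last exact: linear0.
by exists 0; apply: (bij_inj f_bij); rewrite fv [LHS]linear0.
Qed.

Lemma fg_free_lift (P B N : lmodType R) (g : {linear B -> N})
    (v : {linear P -> N}) :
  fg_free P -> epi g -> exists h : {linear P -> B}, forall x, g (h x) = v x.
Proof.
move=> [n [f [f' fK f'K]]] /choice[b bK].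
have f'_lin : linear f' by move=> a x y; rewrite -[x in LHS]f'K -[y in LHS]f'K -linearP fK.
exists (row_ext (fun i => b (v (f (delta_mx 0 i)))) \o linear_pack f'_lin) => x /=.
rewrite [g _]linear_sum -[x in RHS]f'K.
have /= -> := row_linear_eq (v \o f) (f' x).
by apply: eq_bigr => i _; rewrite linearZ bK.
Qed.

(** The images in [M] of the generators of [P] solve the system whose rows are the relations of [P].
    The criterion writes them as [D y] with [A D = 0], and [D] then induces a map from [P] to
    [R^k]. *)
Lemma flat_fp_factor (P M : lmodType R) (v : {linear P -> M}) :
  flat M -> finitely_presented P ->
  exists Q : lmodType R, fg_free Q /\ factors_through Q v.
Proof.
move=> /flat_eq_flat flatM [m [n [q [p [p_epi pq]]]]].
pose A : 'M[R]_(m, n) := \matrix_(i, j) q (delta_mx 0 i) 0 j.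
have qE w : q w = w *m A.
  by apply/rowP=> j; rewrite row_linear_eq summxE mxE; apply: eq_bigr => i _; rewrite !mxE.
have [|k [D [y [AD xD]]]] := ker_span_factor (flatM _ _ A (fun j => v (p (delta_mx 0 j))) _).
  move=> i; have /pq pq0 : exists w, q w = q (delta_mx 0 i) by exists (delta_mx 0 i).
  rewrite -[RHS](linear0 v) -[in RHS]pq0.
  have /= -> := row_linear_eq (v \o p) (q (delta_mx 0 i)).
  by apply: eq_bigr => j _; rewrite mxE.
have [s sK] := choice p_epi.
(* The section [s] is not linear, but [D] kills the kernel of [p], so [s] followed by [D] is. *)
have sD w : s (p w) *m D = w *m D.
  apply/eqP; rewrite -subr_eq0 -mulmxBl.
  have /pq[z <-] : p (s (p w) - w) = 0 by rewrite linearB /= sK subrr.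
  by rewrite qE -mulmxA AD mulmx0.
have u_lin : linear (fun x => s x *m D).
  move=> a x x'; rewrite -[x in LHS]sK -[x' in LHS]sK -linearP sD.
  by rewrite mulmxDl scalemxAl.
exists 'rV[R]_k; split; first exact: fg_free_row.
exists (linear_pack u_lin), (row_ext y) => x.
rewrite -[x in RHS]sK; have /= -> := row_linear_eq (v \o p) (s x).
under [RHS]eq_bigr => j _ do rewrite xD scaler_sumr.
rewrite exchange_big; apply: eq_bigr => i _ /=; rewrite mxE scaler_suml.
by apply: eq_bigr => j _; rewrite scalerA.
Qed.

(** [R] is flat, so the map [R -> N] taking 1 to [y] lifts. *)
Lemma flat_precover_epi (F N : lmodType R) (g : {linear F -> N}) :
  flat_precover g -> epi g.
Proof.
move=> [_ g_cover] y.
have y_lin : linear (fun r : R^o => (r : R) *: y : N).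
  by move=> a r s; rewrite scalerDl scalerA.
have [h gh] := g_cover R^o (eq_flat_flat (@eq_flat_regular R)) (linear_pack y_lin).
by exists (h 1); rewrite gh -[RHS]scale1r.
Qed.

(** Given subprojectivity, the inclusion of [C] lifts to the free module on the set [N]; since [C]
    is finitely generated, only finitely many basis elements occur. Conversely, maps from a finitely
    generated free module lift along epimorphisms. *)
Lemma subprojectivity_f_projective (N : lmodType R) :
  (forall M : lmodType R, finitely_generated M -> subprojectivity_domain M N) <->
  f_projective N.
Proof.
split=> [N_sub S C fgC|projN M fgM B g f g_epi]; last first.
  have [P [freeP [u [v uv]]]] := factors_through_image projN f fgM.
  have [h gh] := fg_free_lift v freeP g_epi.
  by exists (h \o u) => x /=; rewrite gh uv.
pose g : {linear free R N -> N} := free_ext id.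
have [|h gh] := N_sub C fgC _ g \val.
  by move=> y; exists (dirac R y); apply: free_ext_dirac.
have [n [e eC]] := fgC.
pose s := undup (flatten [seq supp (h (e i)) | i <- enum 'I_n]).
have hs x y : y \notin s -> coef (h x) y = 0.
  move=> ys; have [c ->] := eC x; rewrite linear_sum coef_sum big1 // => i _.
  rewrite linearZ coefZ coef_supp ?mulr0 //; apply: contra ys => yi.
  rewrite mem_undup; apply/flatten_mapP; exists i => //; exact: mem_enum.
have u_lin : linear (fun x => \row_(j < size s) coef (h x) (tnth (in_tuple s) j)).
  by move=> a x y; apply/rowP=> j; rewrite !mxE linearP coefD coefZ.
exists 'rV[R]_(size s); split; first exact: fg_free_row.
exists (linear_pack u_lin), (row_ext (tnth (in_tuple s))) => x.
rewrite -gh [RHS](free_extE id (undup_uniq _) (hs x)) big_tnth.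
by apply: eq_bigr => j _; rewrite mxE.
Qed.

End Factorization.

(** * The cycle of implications *)

Theorem proposition3p7 (R : pzRingType) :
  [<-> (forall M : lmodType R, flat M -> f_projective M);
       (forall M : lmodType R, flat M -> mittag_leffler M);
       (forall M : lmodType R, finitely_generated M ->
          forall N : lmodType R,
            flat_precover_completing_domain M N <-> subprojectivity_domain M N);
       (forall N : lmodType R,
          (forall M : lmodType R, finitely_generated M ->
             flat_precover_completing_domain M N) <-> f_projective N)].
Proof.
tfae.
- move=> proj M flatM S C fgC; have [P [freeP uv]] := proj M flatM S C fgC.
  by exists P; split=> //; apply: fg_free_finitely_presented.
- move=> ml M fgM N; split=> [MN B g f g_epi|MN f F g g_cover]; last first.
    by apply: MN; apply: flat_precover_epi.
  (* The hypothesis on [N] speaks only of given precovers, so it yields a lift once one exists. *)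
  have [F [p p_cover]] := exists_flat_precover N.
  have [h ph] := MN f F p p_cover; have [flatF _] := p_cover.
  have [P [fpP [u [v uv]]]] := factors_through_image (ml F flatF) h fgM.
  have [Q [freeQ [u' [v' uv']]]] := flat_fp_factor v flatF fpP.
  have [k gk] := fg_free_lift (p \o v') freeQ g_epi.
  by exists (k \o u' \o u) => x /=; rewrite gk /= uv' uv ph.
- move=> dom N; rewrite -subprojectivity_f_projective.
  by split=> MN M fgM; apply/dom => //; apply: MN.
- move=> dom F flatF; apply/dom => M fgM f G g [_ g_cover].
  (* As [F] is flat, its identity lifts and splits the precover. *)
  have [h gh] := g_cover F flatF idfun.
  by exists (h \o f) => x /=; rewrite gh.
Qed.
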